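(* Let $G=(V,E)\in\mathfrak{Gr}(n,k)$ and let $s$ be an integer with $0\le s\le n$. If $S$ is a subset of $V$ of size $s$ chosen uniformly at random, then $$\mathbb{P}(S\text{ is identifying in }G)\ge 1-\binom{n+1}{2}\frac{\binom{k-1}{s}}{\binom{n}{s}}.$$
   Context: All graphs are finite, simple and undirected. For a graph $G=(V,E)$ and $x\in V$, $N[x]=\{x\}\cup\{y: xy\in E\}$. A set $C\subseteq V$ is identifying if $N[x]\cap C\ne\emptyset$ for every $x\in V$ and $N[x]\cap C\neq N[y]\cap C$ for all distinct $x,y\in V$. For $n\ge k\ge1$, $\mathfrak{Gr}(n,k)$ is the set of graphs on $n$ vertices in which every $k$-element subset of vertices is identifying. *)

(* Defs.v *)
From mathcomp Require Import all_boot all_order all_algebra.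
Set Implicit Arguments.
Unset Strict Implicit.
Unset Printing Implicit Defensive.
Import Order.TTheory GRing.Theory Num.Theory.
Local Open Scope ring_scope.

Record sgraph := SGraph {
  vertex :> finType;
  adj : rel vertex;
  adj_sym : symmetric adj;
  adj_irr : irreflexive adj
}.

Definition closed_nbhd (G : sgraph) (x : G) : {set G} :=
  x |: [set y | adj x y].

Definition identifying (G : sgraph) (C : {set G}) : bool :=
  [forall x : G, closed_nbhd x :&: C != set0] &&
  [forall x : G, forall y : G,
     (x != y) ==> (closed_nbhd x :&: C != closed_nbhd y :&: C)].

(* The range 1 <= k <= n is not part of the definition: it is a side condition
   wherever Gr n k is used. *)
Definition Gr (n k : nat) (G : sgraph) : Prop :=
  #|G| = n /\ (forall C : {set G}, #|C| = k -> identifying C).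

(* Probability of the event A for a uniformly random element of Omega;
   meaningful only when Omega is nonempty. *)
Definition uniform_prob (R : realFieldType) (T : finType)
    (Omega A : {set T}) : R :=
  #|A :&: Omega|%:R / #|Omega|%:R.

Definition subsets_of_size (T : finType) (s : nat) : {set {set T}} :=
  [set S : {set T} | #|S| == s].

(* Main.v *)
Require Import Defs.
From mathcomp Require Import all_boot all_order all_algebra.
Set Implicit Arguments.
Unset Strict Implicit.
Unset Printing Implicit Defensive.
Import Order.TTheory GRing.Theory Num.Theory.
Local Open Scope ring_scope.

(** A set S fails to be identifying iff it misses one of the 'C(n.+1, 2) sets
    N[x] and N[x] + N[y] (symmetric difference, x != y).  The complement of each
    of these sets has fewer than k elements, since a k-subset of it would not be
    identifying; so it contains at most 'C(k.-1, s) of the s-subsets, and the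
    union bound concludes. *)

(* The two kinds of sets to be hit are treated at once as sums over F_2 of the
   closed neighbourhoods of the elements of a set P of size 1 or 2. *)
Definition nbhd_sum (G : sgraph) (P : {set G}) : {set G} :=
  [set z | odd (\sum_(x in P) (z \in closed_nbhd x))].

Lemma nbhd_sum1 (G : sgraph) (x : G) : nbhd_sum [set x] = closed_nbhd x.
Proof. by apply/setP=> z; rewrite inE big_set1 oddb. Qed.

(** Over F_2 the sum of two neighbourhoods is their symmetric difference, so missing it means that
    [x] and [y] have the same trace on [C]. *)
Lemma nbhd_sum2_disjoint (G : sgraph) (x y : G) (C : {set G}) : x != y ->
  [disjoint nbhd_sum [set x; y] & C] =
  (closed_nbhd x :&: C == closed_nbhd y :&: C).
Proof.
move=> neq_xy.
have memE z : (z \in nbhd_sum [set x; y]) =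
    (z \in closed_nbhd x) (+) (z \in closed_nbhd y).
  by rewrite inE big_setU1 ?in_set1 //= big_set1 oddD !oddb.
apply/pred0P/eqP => [dis|eqC z].
  apply/setP=> z; rewrite !in_setI.
  by have /= := dis z; rewrite memE; do 3 case: (z \in _).
by move/setP/(_ z): eqC; rewrite /= memE !in_setI; do 3 case: (z \in _).
Qed.

(** A singleton [P] witnesses an undominated vertex, a pair [P] two vertices that [C] does not
    separate. *)
Lemma not_identifyingP (G : sgraph) (C : {set G}) :
  reflect (exists2 P : {set G},
             (#|P| == 1%N) || (#|P| == 2) & [disjoint nbhd_sum P & C])
          (~~ identifying C).
Proof.
rewrite /identifying negb_and; apply: (iffP orP) => [[]|[P]].
- case/forallPn=> x; rewrite negbK => dis.
  by exists [set x]; rewrite ?cards1 // nbhd_sum1 -setI_eq0.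
- case/forallPn=> x /forallPn[y]; rewrite negb_imply negbK => /andP[nxy eqC].
  by exists [set x; y]; rewrite ?nbhd_sum2_disjoint // cards2 nxy.
case/orP=> [/cards1P[x ->]|/cards2P[x [y [nxy ->]]]] dis.
  left; apply/forallPn; exists x.
  by rewrite negbK setI_eq0 -nbhd_sum1.
right; apply/forallPn; exists x; apply/forallPn; exists y.
by rewrite negb_imply nxy negbK -nbhd_sum2_disjoint.
Qed.

Lemma card_setC_nbhd_sum (n k : nat) (G : sgraph) (P : {set G}) :
  Gr n k G -> (#|P| == 1%N) || (#|P| == 2) -> (#|~: nbhd_sum P| < k)%N.
Proof.
(* If the complement had at least [k] elements, the binomial counting its [k]-subsets would be
   positive, which provides such a subset [C]. *)
move=> [_ idG] cardP; rewrite ltnNge -bin_gt0 -cards_draws card_gt0.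
apply/set0Pn=> -[C]; rewrite inE subsets_disjoint setCK disjoint_sym.
case/andP=> dis /eqP/idG; apply/negP/not_identifyingP.
by exists P.
Qed.

Lemma card_sets12 (T : finType) :
  #|[set P : {set T} | (#|P| == 1%N) || (#|P| == 2)]| = 'C(#|T|.+1, 2).
Proof.
have ->: [set P : {set T} | (#|P| == 1%N) || (#|P| == 2)] =
    [set P : {set T} | #|P| == 1%N] :|: [set P : {set T} | #|P| == 2].
  by apply/setP=> P; rewrite !inE.
(* The two families are disjoint, and Pascal's rule adds their sizes. *)
rewrite cardsU !card_draws (_ : _ :&: _ = set0) ?cards0 ?subn0 1?addnC //.
by apply/setP=> P; rewrite !inE; case: eqP => // ->.
Qed.

Lemma card_bigcup_leq (I T : finType) (A : {set I}) (F : I -> {set T}) :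
  (#|\bigcup_(i in A) F i| <= \sum_(i in A) #|F i|)%N.
Proof.
elim/big_rec2: _ => [|i m X _ leXm]; first by rewrite cards0.
by rewrite cardsU (leq_trans (leq_subr _ _)) ?leq_add2l.
Qed.

Lemma card_not_identifying (n k s : nat) (G : sgraph) : Gr n k G ->
  (#|subsets_of_size G s :\: [set S | identifying S]|
     <= 'C(n.+1, 2) * 'C(k.-1, s))%N.
Proof.
move=> GrG; have [<- _] := GrG; rewrite -card_sets12 -sum_nat_const.
pose missing P := [set S : {set G} | S \subset ~: nbhd_sum P & #|S| == s].
have sub_missing : subsets_of_size G s :\: [set S | identifying S] \subset
    \bigcup_(P in [set P : {set G} | (#|P| == 1%N) || (#|P| == 2)]) missing P.
  apply/subsetP=> S; rewrite in_setD !inE.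
  case/andP=> /not_identifyingP[P cardP dis] cardS.
  apply/bigcupP; exists P; rewrite !inE //.
  by rewrite subsets_disjoint setCK disjoint_sym dis.
apply: leq_trans (subset_leq_card sub_missing) _.
apply: leq_trans (card_bigcup_leq _ _) _.
apply: leq_sum => P; rewrite inE => cardP; rewrite cards_draws leq_bin2l //.
(* The strict bound by [k] rules out [k = 0], where [k.-1] would be a default value, and otherwise
   gives the bound by [k.-1]. *)
have := card_setC_nbhd_sum GrG cardP.
by case: k {GrG}.
Qed.

Theorem theorem31 (R : realFieldType) (n k s : nat) (G : sgraph)
    (hk : (1 <= k <= n)%N) (hG : Gr n k G) (hs : (s <= n)%N) :
  uniform_prob R (subsets_of_size G s) [set S : {set G} | identifying S]
    >= 1 - 'C(n.+1, 2)%:R * ('C(k.-1, s)%:R / 'C(n, s)%:R).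
Proof.
have cardO : #|subsets_of_size G s| = 'C(n, s).
  by rewrite card_draws; case: hG => ->.
have bin_gt0R : 0 < 'C(n, s)%:R :> R by rewrite ltr0n bin_gt0.
(* Writing 1 as ['C(n, s) / 'C(n, s)] lets the common denominator cancel; what remains is an
   inequality between natural numbers. *)
rewrite /uniform_prob cardO mulrA -{1}(divff (lt0r_neq0 bin_gt0R)) -mulrBl.
rewrite ler_pM2r ?invr_gt0 // lerBlDr -natrM -natrD ler_nat -cardO setIC.
by rewrite -(cardsID [set S | identifying S]) leq_add2l card_not_identifying.
Qed.
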